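(* \begin{enumerate} \item Every finite $\partial$-graph $G$ can be layer-stripped (by a finite sequence of layer-stripping operations) to a unique flower; denote this sub-$\partial$-graph of $G$ by $\mathrm{Fl}(G)$. \item There is exactly one flower in each layerable equivalence class of finite $\partial$-graphs. \item If $f:G\to H$ is an unramified $\partial$-graph morphism between finite $\partial$-graphs, then $\mathrm{Fl}(G)\subseteq f^{-1}(\mathrm{Fl}(H))$. \item $\mathrm{Fl}$ is a functor from the category of finite $\partial$-graphs and unramified $\partial$-graph morphisms to itself (acting on morphisms by restriction), and the inclusions $\mathrm{Fl}(G)\to G$ form a natural transformation $\mathrm{Fl}\to\mathrm{id}$. \end{enumerate}
   Context: Graphs are undirected multigraphs with vertex set $V$ and set $E$ of oriented edges (each undirected edge gives $e$ and its reverse $\overline{e}$); $e_+$, $e_-$ are the starting and ending vertices of $e$; $\mathcal{E}(x)=\{e: e_+=x\}$. A $\partial$-graph is a graph with a partition $V=V^\circ\sqcup\partial V$ (interior and boundary vertices). A $\partial$-graph morphism $f:G_1\to G_2$ is a map $f:V_1\sqcup E_1\to V_2\sqcup E_2$ such that: (1) $f$ maps vertices to vertices; (2) $f$ maps interior vertices to interior vertices; (3) if $f(e)$ is an oriented edge then $f(e_\pm)=f(e)_\pm$ and $f(\overline{e})=\overline{f(e)}$; (4) if $f(e)$ is a vertex then $f(\overline{e})=f(e)$ and $f(e_\pm)=f(e)$; (5) for every $x\in V_1^\circ$ the restricted map $\mathcal{E}(x)\cap f^{-1}(E_2)\to\mathcal{E}(f(x))$ is $n$-to-$1$ for some integer $n\ge0$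 depending on $x$. It is unramified if for all $x\in V_1$ and $e\in\mathcal{E}(f(x))$, $|\mathcal{E}(x)\cap f^{-1}(e)|=1$ when $x\in V_1^\circ$ and $\le1$ when $x\in\partial V_1$. A subgraph $G_1$ of $G_2$ with its own boundary structure is a sub-$\partial$-graph ($G_1\subseteq G_2$) if the inclusion is a $\partial$-graph morphism, equivalently $x\in V_1^\circ$ implies $x\in V_2^\circ$ and $\mathcal{E}_{G_1}(x)=\mathcal{E}_{G_2}(x)$. For a $\partial$-graph morphism $f:G\to H$ and a sub-$\partial$-graph $H'\subseteq H$, $f^{-1}(H')$ is the sub-$\partial$-graph of $G$ with vertices and edges $f^{-1}(V(H')\sqcup E(H'))$ and interior vertices $f^{-1}(V^\circ(H'))\cap V^\circ(G)$. Layer-stripping operations on a $\partial$-graph $G'$, producing a sub-$\partial$-graph $G$: deleting an isolated boundary vertex (a boundary vertex with no incident edges); deleting a boundary edge (an edge, together with its reverse, both of whose endpoints are boundary vertices); contracting a boundary spike, i.e. an edge $e$ such that $e_-$ is interior and $e_+$ is a boundary vertex with no other incident edges: here $V(G)=V(G')\setminus\{e_+\}$, $E(G)=E(G')\setminus\{e,\overline{e}\}$, $V^\circ(G)=V^\circ(G')\setminus\{e_-\}$ (so $e_-$ becomes a boundary vertex). A flower is a $\partial$-graph with no boundary spikes, boundary edges, or isolated boundary vertices. Two finite $\partial$-graphs $G,G'$ are layerably equivalent if there is a finite sequence $G=G_0,G_1,\dots,G_n=G'$ such that for each $j$ one of $G_j,G_{j+1}$ is obtained from the other by a layer-stripping operation.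 *)

(* Defs.v *)
From Stdlib Require Export Relations.Relation_Operators.
From Stdlib Require Import ProofIrrelevance.
From mathcomp Require Export all_boot finmap.

Set Implicit Arguments.
Unset Strict Implicit.
Unset Printing Implicit Defensive.

Local Open Scope fset_scope.

(* The vertices and oriented edges of a finite ∂-graph are finite sets of
   elements of ambient types U and W, so that two ∂-graphs with the same
   ambient types can be compared literally: Leibniz equality means same
   vertices, edges, interior and incidence, with no isomorphism involved.
   Loops and multiple edges are allowed; a loop also has two orientations. *)
Record dgraph (U W : choiceType) := DGraph {
  verts : {fset U};
  edges : {fset W};
  inter : {fset U};
  start : {ffun edges -> verts};
  rev : {ffun edges -> edges};
  inter_sub : inter `<=` verts;
  revK : involutive rev;
  rev_neq : forall e, rev e != e
}.
Arguments start {U W d}.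
Arguments rev {U W d}.

Section Basics.
Variables U W : choiceType.
Implicit Types G H : dgraph U W.

Definition finish G (e : edges G) : verts G := start (rev e).

Definition interior G (x : verts G) : bool := val x \in inter G.
Definition boundary G (x : verts G) : bool := val x \notin inter G.

Definition out G (x : verts G) : {set edges G} := [set e | start e == x].

Definition cell G : finType := (verts G + edges G)%type.

Definition cval G (c : cell G) : (U + W)%type :=
  match c with inl x => inl (val x) | inr e => inr (val e) end.

Definition in_cells G (c : U + W) : bool :=
  match c with inl u => u \in verts G | inr w => w \in edges G end.

(* Agreement of the stars of interior vertices is slightly more than [is_mor]
   asks of the inclusion, where an interior vertex isolated in G could have
   edges in H (fibres of size 0). *)
Record subdgraph G H : Prop := SubDGraph {
  sub_verts : verts G `<=` verts H;
  sub_edges : edges G `<=` edges H;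
  sub_start : forall (e : edges G) (e' : edges H), val e = val e' ->
    val (start e) = val (start e');
  sub_rev : forall (e : edges G) (e' : edges H), val e = val e' ->
    val (rev e) = val (rev e');
  sub_inter : forall (x : verts G) (x' : verts H), val x = val x' ->
    interior x ->
    interior x' /\ [fset val e | e in out x] = [fset val e | e in out x']
}.

Definition isolated_boundary_vertex G (x : verts G) : bool :=
  boundary x && (out x == set0).

Definition boundary_edge G (e : edges G) : bool :=
  boundary (start e) && boundary (finish e).

(* A boundary vertex with a single outgoing edge e has no other incident
   edge: an edge ending there is the reverse of an outgoing one. *)
Definition boundary_spike G (e : edges G) : bool :=
  [&& interior (finish e), boundary (start e) & out (start e) == [set e]].

(* G is obtained from G' by one layer-stripping operation; [subdgraph] says
   that incidence and reversal are inherited from G'. *)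
Inductive layer_strip G' G : Prop :=
| DeleteVertex (x : verts G') of isolated_boundary_vertex x
    & verts G = verts G' `\ val x & edges G = edges G'
    & inter G = inter G' & subdgraph G G'
| DeleteEdge (e : edges G') of boundary_edge e
    & verts G = verts G' & edges G = edges G' `\` [fset val e; val (rev e)]
    & inter G = inter G' & subdgraph G G'
| ContractSpike (e : edges G') of boundary_spike e
    & verts G = verts G' `\ val (start e)
    & edges G = edges G' `\` [fset val e; val (rev e)]
    & inter G = inter G' `\ val (finish e) & subdgraph G G'.

Definition layer_strips : dgraph U W -> dgraph U W -> Prop :=
  @clos_refl_trans (dgraph U W) layer_strip.

Definition layerably_equivalent : dgraph U W -> dgraph U W -> Prop :=
  @clos_refl_trans (dgraph U W)
    (fun G G' => layer_strip G G' \/ layer_strip G' G).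

Definition flower G : Prop :=
  [/\ forall e : edges G, ~~ boundary_spike e,
      forall e : edges G, ~~ boundary_edge e
    & forall x : verts G, ~~ isolated_boundary_vertex x].

End Basics.

Record is_mor (U W U' W' : choiceType) (G : dgraph U W) (H : dgraph U' W')
    (f : cell G -> cell H) : Prop := IsMor {
  mor_vert : forall x : verts G, exists y : verts H, f (inl x) = inl y;
  mor_inter : forall (x : verts G) (y : verts H), f (inl x) = inl y ->
    interior x -> interior y;
  mor_edge : forall (e : edges G) (e' : edges H), f (inr e) = inr e' ->
    [/\ f (inl (start e)) = inl (start e'),
        f (inl (finish e)) = inl (finish e')
      & f (inr (rev e)) = inr (rev e')];
  mor_collapse : forall (e : edges G) (y : verts H), f (inr e) = inl y ->
    [/\ f (inr (rev e)) = inl y, f (inl (start e)) = inl y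
      & f (inl (finish e)) = inl y];
  mor_fibre : forall (x : verts G) (y : verts H), f (inl x) = inl y ->
    interior x ->
    exists n : nat, forall e' : edges H, e' \in out y ->
      #|[set e in out x | f (inr e) == inr e']| = n
}.

Definition unramified (U W U' W' : choiceType)
    (G : dgraph U W) (H : dgraph U' W') (f : cell G -> cell H) : Prop :=
  forall (x : verts G) (y : verts H), f (inl x) = inl y ->
  forall e' : edges H, e' \in out y ->
    if interior x then #|[set e in out x | f (inr e) == inr e']| = 1
    else #|[set e in out x | f (inr e) == inr e']| <= 1.

Record mor (U W U' W' : choiceType) (G : dgraph U W) (H : dgraph U' W') :=
  Mor { mor_fun :> {ffun cell G -> cell H}; mor_is_mor : is_mor mor_fun }.

Record umor (U W U' W' : choiceType) (G : dgraph U W) (H : dgraph U' W') :=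
  UMor { umor_mor :> mor G H; umor_unramified : unramified umor_mor }.

Section Preimage.
Variables (U W U' W' : choiceType) (G : dgraph U W) (H : dgraph U' W').
Variables (f : mor G H) (H' : dgraph U' W').
Hypothesis sHH : subdgraph H' H.

Definition preim_verts : {fset U} :=
  [fset val x | x : verts G & in_cells H' (cval (f (inl x)))].
Definition preim_edges : {fset W} :=
  [fset val e | e : edges G & in_cells H' (cval (f (inr e)))].
Definition preim_inter : {fset U} :=
  [fset val x | x : verts G & interior x &&
     (if f (inl x) is inl y then val y \in inter H' else false)].

Lemma preim_vertsP (x : verts G) :
  (val x \in preim_verts) = in_cells H' (cval (f (inl x))).
Proof.
apply/imfsetP/idP => [[y /= yP /val_inj ->]|xP]; first exact: yP.
by exists x.
Qed.

Lemma preim_edgesP (e : edges G) :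
  (val e \in preim_edges) = in_cells H' (cval (f (inr e))).
Proof.
apply/imfsetP/idP => [[y /= yP /val_inj ->]|xP]; first exact: yP.
by exists e.
Qed.

Lemma preim_edge_sub : preim_edges `<=` edges G.
Proof. by apply/fsubsetP => w /imfsetP[e _ ->]; apply: fsvalP. Qed.

Lemma preim_start_in (e : preim_edges) :
  val (start (fincl preim_edge_sub e)) \in preim_verts.
Proof.
set e1 := fincl _ _.
have: val e1 \in preim_edges by apply: fsvalP.
rewrite preim_vertsP preim_edgesP.
case E: (f (inr e1)) => [y|e'].
  by have [_ -> _] := mor_collapse (mor_is_mor f) E.
have [-> _ _] := mor_edge (mor_is_mor f) E; move=> /= e'H.
by rewrite -(sub_start sHH (e := [` e'H]) (e' := e')) //; apply: fsvalP.
Qed.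

Lemma preim_rev_in (e : preim_edges) :
  val (rev (fincl preim_edge_sub e)) \in preim_edges.
Proof.
set e1 := fincl _ _.
have: val e1 \in preim_edges by apply: fsvalP.
rewrite !preim_edgesP.
case E: (f (inr e1)) => [y|e'].
  by have [-> _ _] := mor_collapse (mor_is_mor f) E.
have [_ _ ->] := mor_edge (mor_is_mor f) E; move=> /= e'H.
by rewrite -(sub_rev sHH (e := [` e'H]) (e' := e')) //; apply: fsvalP.
Qed.

Definition preim_start : {ffun preim_edges -> preim_verts} :=
  [ffun e => [` preim_start_in e]].
Definition preim_rev : {ffun preim_edges -> preim_edges} :=
  [ffun e => [` preim_rev_in e]].

Lemma preim_inter_sub : preim_inter `<=` preim_verts.
Proof.
apply/fsubsetP => u /imfsetP[x /= /andP[_ xP] ->].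
rewrite preim_vertsP; case: (f (inl x)) xP => //= y.
exact: (fsubsetP (inter_sub H')).
Qed.

Lemma preim_revK : involutive preim_rev.
Proof.
move=> e; apply: val_inj; rewrite !ffunE /=.
set e1 := fincl _ [` _].
have -> : e1 = rev (fincl preim_edge_sub e) by apply: val_inj.
by rewrite revK.
Qed.

Lemma preim_rev_neq e : preim_rev e != e.
Proof.
apply/eqP => /(congr1 val); rewrite ffunE /= => E.
have /eqP[] := rev_neq (fincl preim_edge_sub e).
exact: val_inj.
Qed.

Definition preim_dgraph : dgraph U W :=
  DGraph preim_start preim_inter_sub preim_revK preim_rev_neq.

End Preimage.

Section Composition.
Variables (U1 W1 U2 W2 U3 W3 : choiceType).
Variables (G1 : dgraph U1 W1) (G2 : dgraph U2 W2) (G3 : dgraph U3 W3).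

Lemma mor_eq (f g : mor G1 G2) : mor_fun f = mor_fun g -> f = g.
Proof.
case: f g => [f fP] [g gP] /= E; rewrite -E in gP *.
by rewrite (proof_irrelevance _ fP gP).
Qed.

Lemma umor_eq (f g : umor G1 G2) : (forall c, f c = g c) -> f = g.
Proof.
case: f g => [f fP] [g gP] /= E.
have Efg : f = g by apply/mor_eq/ffunP.
by rewrite -Efg in gP *; rewrite (proof_irrelevance _ fP gP).
Qed.

Definition id_fun : {ffun cell G1 -> cell G1} := [ffun c => c].

Lemma id_unramified : unramified id_fun.
Proof.
move=> x y; rewrite ffunE => -[<-] e' e'x.
suff -> : [set e in out x | id_fun (inr e) == inr e'] = [set e'].
  by rewrite cards1; case: ifP.
apply/setP => e; rewrite [LHS]in_set in_set1 ffunE.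
by apply/andP/eqP => [[_ /eqP[]]|->].
Qed.

Lemma id_is_mor : is_mor id_fun.
Proof.
split.
- by move=> x; exists x; rewrite ffunE.
- by move=> x y; rewrite ffunE => -[<-].
- by move=> e e'; rewrite ffunE => -[<-]; rewrite !ffunE.
- by move=> e y; rewrite ffunE.
- move=> x y xy xI; exists 1 => e' e'y.
  by have := id_unramified xy e'y; rewrite xI.
Qed.

Definition idu : umor G1 G1 := UMor (umor_mor := Mor id_is_mor) id_unramified.

Variables (g : umor G2 G3) (f : umor G1 G2).

Definition comp_fun : {ffun cell G1 -> cell G3} := [ffun c => g (f c)].

Lemma comp_unramified : unramified comp_fun.
Proof.
move=> x z; rewrite ffunE.
have [y Ey] := mor_vert (mor_is_mor f) x; rewrite Ey => Ez e' e'z.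
have mf := mor_is_mor f; have mg := mor_is_mor g.
have gP := umor_unramified Ez e'z.
have compE e : e \in [set e in out x | comp_fun (inr e) == inr e'] ->
    exists2 d, f (inr e) = inr d & d \in [set d in out y | g (inr d) == inr e'].
  rewrite in_set ffunE => /andP[]; rewrite in_set => /eqP ex.
  case E: (f (inr e)) => [y'|d] /eqP gE.
    by have [z' Ez'] := mor_vert mg y'; rewrite Ez' in gE.
  exists d => //; rewrite !in_set gE eqxx andbT.
  have [sE _ _] := mor_edge mf E.
  by move: sE; rewrite ex Ey => -[->].
have le1 : #|[set d in out y | g (inr d) == inr e']| <= 1.
  by move: gP; case: ifP => _ // ->.
have lef d : d \in out y -> #|[set e in out x | f (inr e) == inr d]| <= 1.
  by move=> dy; have := umor_unramified Ey dy; case: ifP => _ // ->.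
have lec : #|[set e in out x | comp_fun (inr e) == inr e']| <= 1.
  apply/card_le1_eqP => e1 e2 e1P e2P.
  have [d1 E1 d1P] := compE _ e1P; have [d2 E2 d2P] := compE _ e2P.
  have d12 : d1 = d2 by apply: (card_le1_eqP le1).
  have d1y : d1 \in out y by move: d1P; rewrite in_set => /andP[].
  apply: (card_le1_eqP (lef _ d1y)); rewrite in_set.
    by move: e1P; rewrite in_set => /andP[-> _]; rewrite E1 eqxx.
  by move: e2P; rewrite in_set => /andP[-> _]; rewrite E2 d12 eqxx.
case: ifP => xI //; apply/eqP; rewrite eqn_leq lec /=.
have yI := mor_inter mf Ey xI; move: gP; rewrite yI => /eqP/cards1P[d dE].
have : d \in [set d] by rewrite in_set1.
rewrite -dE in_set => /andP[dy /eqP gd].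
have := umor_unramified Ey dy; rewrite xI => /eqP/cards1P[e eE].
have : e \in [set e] by rewrite in_set1.
rewrite -eE in_set => /andP[ex /eqP fe].
by apply/card_gt0P; exists e; rewrite in_set ex ffunE fe gd eqxx.
Qed.

Lemma comp_is_mor : is_mor comp_fun.
Proof.
have mf := mor_is_mor f; have mg := mor_is_mor g.
split.
- move=> x; have [y Ey] := mor_vert mf x; have [z Ez] := mor_vert mg y.
  by exists z; rewrite ffunE Ey.
- move=> x z; rewrite ffunE; have [y Ey] := mor_vert mf x.
  by rewrite Ey => Ez /(mor_inter mf Ey)/(mor_inter mg Ez).
- move=> e e'; rewrite !ffunE; case E: (f (inr e)) => [y|d] Eg.
    by have [z Ez] := mor_vert mg y; rewrite Ez in Eg.
  by have [-> -> ->] := mor_edge mf E; have [-> -> ->] := mor_edge mg Eg.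
- move=> e z; rewrite !ffunE; case E: (f (inr e)) => [y|d] Eg.
    by have [-> -> ->] := mor_collapse mf E; rewrite Eg.
  by have [-> -> ->] := mor_edge mf E; have [-> -> ->] := mor_collapse mg Eg.
- move=> x z xz xI; exists 1 => e' e'z.
  by have := comp_unramified xz e'z; rewrite xI.
Qed.

Definition compu : umor G1 G3 :=
  UMor (umor_mor := Mor comp_is_mor) comp_unramified.

End Composition.

Record category := Category {
  obj : Type;
  hom : obj -> obj -> Type;
  idm : forall A, hom A A;
  compm : forall A B C, hom B C -> hom A B -> hom A C;
  compmA : forall A B C D (h : hom C D) (g : hom B C) (f : hom A B),
    compm h (compm g f) = compm (compm h g) f;
  compm1l : forall A B (f : hom A B), compm (idm B) f = f;
  compm1r : forall A B (f : hom A B), compm f (idm A) = f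
}.

(* The object map is a parameter, so that it can be prescribed up to
   conversion. *)
Record functor (C D : category) (F : obj C -> obj D) := Functor {
  fmap : forall A B, hom A B -> hom (F A) (F B);
  fmap_id : forall A, fmap (idm A) = idm (F A);
  fmap_comp : forall A B E (g : hom B E) (f : hom A B),
    fmap (compm g f) = compm (fmap g) (fmap f)
}.

Definition id_functor (C : category) : functor (C := C) (D := C) id :=
  @Functor C C id (fun _ _ f => f) (fun _ => erefl) (fun _ _ _ _ _ => erefl).

Record nat_trans (C D : category) (F F' : obj C -> obj D)
    (phi : functor F) (psi : functor F') := NatTrans {
  component : forall A, hom (F A) (F' A);
  naturality : forall A B (f : hom A B),
    compm (component B) (fmap phi f) = compm (fmap psi f) (component A)
}.

Record fin_dgraph := FinDGraph {
  vtype : choiceType;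
  etype : choiceType;
  dgraph_of :> dgraph vtype etype
}.

Definition dgraph_category : category.
Proof.
refine (@Category fin_dgraph (fun G H => umor G H) (fun G => idu G)
          (fun G H K g f => compu g f) _ _ _).
- by move=> A B C D h g f; apply: umor_eq => c; rewrite !ffunE.
- by move=> A B f; apply: umor_eq => c; rewrite !ffunE.
- by move=> A B f; apply: umor_eq => c; rewrite !ffunE.
Defined.

(* Main.v *)
From Stdlib Require Import ProofIrrelevance.
Require Import Defs.

(** A flower can be found by stripping for as long as possible: a ∂-graph that
    is not a flower admits a layer-stripping operation, and each operation
    lowers the number of vertices plus oriented edges ([strip_to_flower]).

    Everything else follows from one observation, [flower_maps_into]: if
    [f : F -> H] is unramified, [F] is a flower and [K] is obtained from [H] by
    one layer-stripping operation, then [f] takes its values in [K] and maps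
    interior vertices of [F] to interior vertices of [K].  Two facts about a
    flower drive the case analysis: a boundary vertex has an incident edge, and
    no edge is collapsed to a boundary vertex, since the ends of that edge
    would be boundary vertices.
    - Were an isolated boundary vertex hit by a vertex [v], the vertex [v] would
      be a boundary vertex, and an edge at [v] would have to be collapsed.
    - An edge mapped to a boundary edge would be a boundary edge.
    - Let [e] be a boundary spike.  Were [start e] hit by [v], every edge at [v]
      would map to [e], so that [v] would have a single edge, because [f] is
      unramified; this edge would be a boundary spike or a boundary edge.
      Hence nothing maps to [start e], nor to [e] or [rev e]; an interior vertex
      mapped to [finish e] would have an edge mapped to [rev e].

    By induction, an unramified morphism from a flower to [H] factors through
    every ∂-graph to which [H] can be layer-stripped ([flower_factor]).  For an
    inclusion [F -> G] this shows that two flowers to which [G] can be stripped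
    contain each other, hence coincide; therefore [Fl] is well defined and
    invariant under layer-stripping, which also gives one flower in each
    layerable equivalence class.  For the composite [Fl G -> G -> H] it shows
    that [f] maps [Fl G] into [Fl H], that is [Fl G] is a sub-∂-graph of the
    preimage of [Fl H], and that [f] restricts to a morphism
    [Fl G -> Fl H]; functoriality and naturality can then be tested on
    underlying cells, because [cval] is injective. *)

Set Implicit Arguments.
Unset Strict Implicit.
Unset Printing Implicit Defensive.

Local Open Scope fset_scope.

(** * Cells and equality of ∂-graphs *)

Section Cells.
Variables U W : choiceType.
Implicit Types G H : dgraph U W.

Lemma cval_inj G : injective (@cval U W G).
Proof. by move=> [x|e] [y|d] //= [] /val_inj ->. Qed.

Lemma in_cells_cval G (c : cell G) : in_cells G (cval c).
Proof. by case: c => c; apply: fsvalP. Qed.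

(** The cell of [G] with a given underlying element; a one-sided inverse of
    [cval]. *)
Definition cell_of G (c : U + W) : in_cells G c -> cell G :=
  match c with
  | inl _ => fun cG => inl [` cG]
  | inr _ => fun cG => inr [` cG]
  end.

Lemma cval_cell_of G c (cG : in_cells G c) : cval (cell_of cG) = c.
Proof. by case: c cG. Qed.

Lemma dgraph_eq G H :
  verts G = verts H -> edges G = edges H -> inter G = inter H ->
  (forall (e : edges G) (e' : edges H), val e = val e' ->
     val (start e) = val (start e') /\ val (rev e) = val (rev e')) ->
  G = H.
Proof.
case: G H => [V E I s r IV rK rN] [V' E' I' s' r' IV' rK' rN'] /= eqV eqE eqI.
rewrite -{}eqV in s' IV' *; rewrite -{}eqE in s' r' rK' rN' *.
rewrite -{}eqI in IV' *.
move=> eq_sr.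
have eqs : s = s' by apply/ffunP => e; apply: val_inj; case: (eq_sr e e).
have eqr : r = r' by apply/ffunP => e; apply: val_inj; case: (eq_sr e e).
rewrite -{}eqs -{}eqr in rK' rN' *.
by rewrite (proof_irrelevance _ IV IV') (proof_irrelevance _ rK rK')
           (proof_irrelevance _ rN rN').
Qed.

End Cells.

(** * Sub-∂-graphs *)

Section Subgraph.
Variables U W : choiceType.
Implicit Types F G H : dgraph U W.

Section Inclusion.
Variables (F G : dgraph U W) (sFG : subdgraph F G).

Let iV : verts F -> verts G := fincl (sub_verts sFG).
Let iE : edges F -> edges G := fincl (sub_edges sFG).

(** The inclusion of a sub-∂-graph on cells. *)
Definition incl (c : cell F) : cell G :=
  match c with inl x => inl (iV x) | inr e => inr (iE e) end.

Lemma cval_incl c : cval (incl c) = cval c.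
Proof. by case: c. Qed.

Lemma incl_inj : injective incl.
Proof. by move=> c d eq_cd; apply: cval_inj; rewrite -!cval_incl eq_cd. Qed.

Lemma start_fincl e : start (iE e) = iV (start e).
Proof. by apply: val_inj; rewrite -(sub_start sFG (e := e)). Qed.

Lemma rev_fincl e : rev (iE e) = iE (rev e).
Proof. by apply: val_inj; rewrite -(sub_rev sFG (e := e)). Qed.

Lemma finish_fincl e : finish (iE e) = iV (finish e).
Proof. by rewrite /finish rev_fincl start_fincl. Qed.

Lemma interior_fincl x : interior x -> interior (iV x).
Proof. by move=> xI; case: (sub_inter sFG (x := x) (x' := iV x)). Qed.

(** The star of an interior vertex of [F] is its whole star in [G]. *)
Lemma interior_star x (e : edges G) :
  interior x -> start e = iV x -> exists2 d : edges F, start d = x & iE d = e.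
Proof.
move=> xI ex; have [//|_ outE] := sub_inter sFG (x := x) (x' := iV x) erefl.
have : val e \in [fset val e | e in out (iV x)].
  by apply/imfsetP; exists e => //=; rewrite inE ex.
rewrite -outE => /imfsetP[d /=]; rewrite inE => /eqP dx ed.
by exists d => //; apply: val_inj; apply: esym.
Qed.

End Inclusion.

Lemma subdgraph_refl G : subdgraph G G.
Proof.
by split=> // [e e' /val_inj ->|e e' /val_inj ->|x x' /val_inj ->].
Qed.

Lemma subdgraph_trans F G H : subdgraph F G -> subdgraph G H -> subdgraph F H.
Proof.
move=> sFG sGH; split.
- exact: fsubset_trans (sub_verts sFG) (sub_verts sGH).
- exact: fsubset_trans (sub_edges sFG) (sub_edges sGH).
- move=> e e' ee'; pose d := fincl (sub_edges sFG) e.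
  by rewrite (sub_start sFG (e' := d)) // (sub_start sGH (e' := e')).
- move=> e e' ee'; pose d := fincl (sub_edges sFG) e.
  by rewrite (sub_rev sFG (e' := d)) // (sub_rev sGH (e' := e')).
- move=> x x' xx'; pose y := fincl (sub_verts sFG) x.
  case/(sub_inter sFG (x := x) (x' := y) erefl) => yI ->.
  exact: (sub_inter sGH (x := y) (x' := x')).
Qed.

Lemma layer_strips_sub G F : layer_strips G F -> subdgraph F G.
Proof.
elim=> [{}G {}F []//|{}G|G1 G2 G3 _ s21 _ s32]; first exact: subdgraph_refl.
exact: subdgraph_trans s32 s21.
Qed.

(** The sub-∂-graph of [G] on given sets [V], [E], [I] of vertices, edges and
    interior vertices, with the incidence of [G]. *)
Section Build.
Variables (G : dgraph U W) (V : {fset U}) (E : {fset W}) (I : {fset U}).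
Hypotheses (VG : V `<=` verts G) (EG : E `<=` edges G).
Hypotheses (IV : I `<=` V) (IG : I `<=` inter G).
Hypothesis startE : forall e : edges G, val e \in E -> val (start e) \in V.
Hypothesis revE : forall e : edges G, val e \in E -> val (rev e) \in E.
Hypothesis starE : forall e : edges G, val (start e) \in I -> val e \in E.

Definition build_start : {ffun E -> V} :=
  [ffun e => [` startE (e := fincl EG e) (fsvalP e)]].
Definition build_rev : {ffun E -> E} :=
  [ffun e => [` revE (e := fincl EG e) (fsvalP e)]].

Lemma build_revK : involutive build_rev.
Proof.
move=> e; apply: val_inj; rewrite !ffunE /=.
set d := fincl _ [` _].
have -> : d = rev (fincl EG e) by apply: val_inj.
by rewrite revK.
Qed.

Lemma build_rev_neq e : build_rev e != e.
Proof.
apply/eqP => /(congr1 val); rewrite ffunE /= => eqe.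
by have /eqP[] := rev_neq (fincl EG e); apply: val_inj.
Qed.

Definition build : dgraph U W :=
  DGraph build_start IV build_revK build_rev_neq.

Lemma build_sub : subdgraph build G.
Proof.
split=> //= [e e' ee'|e e' ee'|x x' xx' xI].
- by rewrite ffunE /=; congr (val (start _)); apply: val_inj.
- by rewrite ffunE /=; congr (val (rev _)); apply: val_inj.
split; first by rewrite /interior [val x'](esym xx'); apply: (fsubsetP IG).
apply/fsetP => w; apply/imfsetP/imfsetP => -[e /=]; rewrite inE => /eqP ex ->.
  exists (fincl EG e) => //=; rewrite inE; apply/eqP/val_inj.
  by rewrite /= -xx' -ex ffunE.
have eE : val e \in E by apply: starE; rewrite ex [val x'](esym xx').
exists [` eE] => //=; rewrite inE; apply/eqP/val_inj; rewrite ffunE /= xx' -ex.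
by congr (val (start _)); apply: val_inj.
Qed.

End Build.


(** * Layer-stripping to a flower *)

(** The number of vertices and oriented edges, which every layer-stripping
    operation lowers. *)
Definition dsize G := (#|` verts G| + #|` edges G|)%N.

Lemma delete_vertex G (x : verts G) : isolated_boundary_vertex x ->
  {K | layer_strip G K & dsize K < dsize G}.
Proof.
move=> xP; case/andP: (xP) => xB /eqP x0.
have xout (e : edges G) : val (start e) != val x.
  apply: contraTneq isT => /val_inj ex.
  by have := in_set0 e; rewrite -x0 inE ex eqxx.
have sV : verts G `\ val x `<=` verts G by apply: fsubD1set.
have sIV : inter G `<=` verts G `\ val x.
  by apply/fsubsetD1P; split; [apply: inter_sub | apply: xB].
have startE (e : edges G) :
    val e \in edges G -> val (start e) \in verts G `\ val x.
  by move=> _; rewrite !inE xout fsvalP.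
pose K := @build G _ (edges G) (inter G) (fsubset_refl _) sIV startE
  (fun e _ => fsvalP (rev e)).
exists K; last first.
  by rewrite /dsize /= ltn_add2r [X in _ < X](cardfsD1 (val x)) fsvalP.
by apply: (DeleteVertex xP) => //; apply: build_sub => // e _; apply: fsvalP.
Qed.

Lemma in_edgesD2 G (e d : edges G) :
  (val d \in edges G `\` [fset val e; val (rev e)]) =
  (d != e) && (d != rev e).
Proof. by rewrite !inE fsvalP andbT negb_or !(inj_eq val_inj). Qed.

Lemma revD2 G (e d : edges G) :
  val d \in edges G `\` [fset val e; val (rev e)] ->
  val (rev d) \in edges G `\` [fset val e; val (rev e)].
Proof.
rewrite !in_edgesD2 => /andP[de dre]; rewrite (inj_eq (inv_inj (@revK _ _ G))).
by rewrite de -{1}(revK e) (inj_eq (inv_inj (@revK _ _ G))) dre.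
Qed.

Lemma card_edgesD2 G (e : edges G) :
  #|` edges G `\` [fset val e; val (rev e)]| < #|` edges G|.
Proof.
apply: fproper_ltn_card; rewrite fproperE fsubsetDl /=.
by apply/fsubsetPn; exists (val e); [apply: fsvalP | rewrite in_edgesD2 eqxx].
Qed.

Lemma delete_edge G (e : edges G) : boundary_edge e ->
  {K | layer_strip G K & dsize K < dsize G}.
Proof.
move=> eP; case/andP: (eP) => sB fB.
have starE (d : edges G) : val (start d) \in inter G ->
    val d \in edges G `\` [fset val e; val (rev e)].
  move=> dI; rewrite in_edgesD2; apply/andP; split; apply: contraTneq dI => ->.
    exact: sB.
  exact: fB.
pose K := @build G (verts G) _ (inter G) (fsubsetDl _ _)
  (inter_sub G) (fun d _ => fsvalP (start d)) (@revD2 G e).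
exists K; last by rewrite /dsize /= ltn_add2l card_edgesD2.
by apply: (DeleteEdge eP) => //; apply: build_sub.
Qed.

Lemma contract_spike G (e : edges G) : boundary_spike e ->
  {K | layer_strip G K & dsize K < dsize G}.
Proof.
move=> eP; case/and3P: (eP) => fI sB /eqP oute.
have sV : verts G `\ val (start e) `<=` verts G by apply: fsubD1set.
have sI : inter G `\ val (finish e) `<=` inter G by apply: fsubD1set.
have sIV : inter G `\ val (finish e) `<=` verts G `\ val (start e).
  apply/fsubsetD1P; split; first exact: fsubset_trans sI (inter_sub G).
  by rewrite in_fsetD1; apply/nandP; right; apply: sB.
have startE (d : edges G) : val d \in edges G `\` [fset val e; val (rev e)] ->
    val (start d) \in verts G `\ val (start e).
  rewrite in_edgesD2 => /andP[de _]; rewrite !inE fsvalP andbT.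
  rewrite (inj_eq val_inj); apply: contraNneq de => ds.
  by rewrite -in_set1 -oute inE ds.
have starE (d : edges G) : val (start d) \in inter G `\ val (finish e) ->
    val d \in edges G `\` [fset val e; val (rev e)].
  rewrite !in_fsetD1 => /andP[df dI]; rewrite in_edgesD2; apply/andP; split.
    by apply: contraTneq dI => ->; apply: sB.
  by apply: contraNneq df => ->.
pose K := @build G _ _ _ (fsubsetDl _ _) sIV startE (@revD2 G e).
exists K; last first.
  by rewrite /dsize /= -addnS leq_add ?card_edgesD2 // fsubset_leq_card.
by apply: (ContractSpike eP) => //; apply: build_sub.
Qed.

Lemma flower_or_strip G :
  flower G + {K | layer_strip G K & dsize K < dsize G}.
Proof.
case: (pickP (@boundary_spike U W G)) => [e /contract_spike|no_spike].
  by right.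
case: (pickP (@boundary_edge U W G)) => [e /delete_edge|no_edge]; first by right.
case: (pickP (@isolated_boundary_vertex U W G)) => [x /delete_vertex|no_vert].
  by right.
by left; split=> z; rewrite ?no_spike ?no_edge ?no_vert.
Qed.

Lemma strip_to_flower G : {F | layer_strips G F & flower F}.
Proof.
have [n] := ubnP (dsize G); elim: n => // n IHn in G *; rewrite ltnS => leGn.
have [flG|[K GK ltKG]] := flower_or_strip G.
  by exists G => //; apply: rt_refl.
have [F KF flF] := IHn K (leq_trans ltKG leGn).
by exists F => //; apply: rt_trans KF; apply: rt_step.
Qed.

(** The flower of [G]; the choice of a stripping sequence does not matter, by
    [Fl_unique] below. *)
Definition Fl G : dgraph U W := s2val (strip_to_flower G).

Lemma Fl_strips G : layer_strips G (Fl G).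
Proof. exact: s2valP. Qed.

Lemma Fl_flower G : flower (Fl G).
Proof. exact: s2valP'. Qed.

Lemma Fl_sub G : subdgraph (Fl G) G.
Proof. exact/layer_strips_sub/Fl_strips. Qed.

End Subgraph.

(** * Unramified morphisms and their restrictions *)

Section Unramified.
Variables (U W U' W' : choiceType) (G : dgraph U W) (H : dgraph U' W').

(** An unramified morphism is injective on the uncollapsed edges at a given
    vertex. *)
Lemma umor_inj (f : umor G H) (e1 e2 : edges G) (d : edges H) :
  start e1 = start e2 -> f (inr e1) = inr d -> f (inr e2) = inr d -> e1 = e2.
Proof.
move=> e12 f1 f2; have [fs _ _] := mor_edge (mor_is_mor f) f1.
have d_out : d \in out (start d) by rewrite inE.
have le1 : #|[set e in out (start e1) | f (inr e) == inr d]| <= 1.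
  by have := umor_unramified fs d_out; case: ifP => // _ ->.
by apply: (card_le1_eqP le1); rewrite !inE ?f1 ?f2 ?e12 !eqxx.
Qed.

(** An unramified morphism has the edge-lifting property at interior
    vertices. *)
Lemma umor_lift (f : umor G H) (x : verts G) (d : edges H) :
  interior x -> f (inl x) = inl (start d) ->
  exists2 e, start e = x & f (inr e) = inr d.
Proof.
move=> xI fx; have d_out : d \in out (start d) by rewrite inE.
have := umor_unramified fx d_out; rewrite xI => /eqP/cards1P[e /setP/(_ e)].
by rewrite !inE eqxx => /andP[/eqP ex /eqP fe]; exists e.
Qed.

(** Injectivity on stars and lifting at interior vertices characterize
    unramified maps. *)
Lemma unramifiedI (f : cell G -> cell H) :
  (forall (e1 e2 : edges G) (d : edges H), start e1 = start e2 ->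
     f (inr e1) = inr d -> f (inr e2) = inr d -> e1 = e2) ->
  (forall (x : verts G) (d : edges H), interior x ->
     f (inl x) = inl (start d) -> exists2 e, start e = x & f (inr e) = inr d) ->
  unramified f.
Proof.
move=> f_inj f_lift x y fx d; rewrite inE => /eqP dy.
have le1 : #|[set e in out x | f (inr e) == inr d]| <= 1.
  apply/card_le1_eqP => e1 e2; rewrite !inE => /andP[/eqP e1x /eqP f1].
  by case/andP=> /eqP e2x /eqP f2; apply: (f_inj _ _ d); rewrite ?e1x.
case: ifP => // xI; apply/eqP; rewrite eqn_leq le1 card_gt0 /=.
have [|e ex fe] := f_lift x d xI; first by rewrite dy.
by apply/set0Pn; exists e; rewrite !inE ex fe !eqxx.
Qed.

End Unramified.

Section Restriction.
Variables (U W U' W' : choiceType) (G : dgraph U W) (H : dgraph U' W').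

(** [f] maps the sub-∂-graph [F] of its source into the sub-∂-graph [K] of its
    target, and interior vertices of [F] to interior vertices of [K]. *)
Record maps_into (f : umor G H) (F : dgraph U W) (K : dgraph U' W') : Prop :=
  MapsInto {
    maps_cells : forall c : cell G,
      in_cells F (cval c) -> in_cells K (cval (f c));
    maps_inter : forall (x : verts G) (y : verts H), f (inl x) = inl y ->
      val x \in inter F -> val y \in inter K
  }.

Section Restrict.
Variables (f : umor G H) (F : dgraph U W) (K : dgraph U' W').
Hypotheses (sFG : subdgraph F G) (sKH : subdgraph K H).
Hypothesis fFK : maps_into f F K.

Lemma restrict_in (c : cell F) : in_cells K (cval (f (incl sFG c))).
Proof. by apply: (maps_cells fFK); rewrite cval_incl in_cells_cval. Qed.

Definition restrict_fun : {ffun cell F -> cell K} :=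
  [ffun c => cell_of (restrict_in c)].

Lemma restrictE c d :
  restrict_fun c = d <-> f (incl sFG c) = incl sKH d.
Proof.
rewrite ffunE; split=> [<-|fcd]; apply: cval_inj.
  by rewrite cval_incl cval_cell_of.
by rewrite cval_cell_of fcd cval_incl.
Qed.

Lemma restrict_unramified : unramified restrict_fun.
Proof.
apply: unramifiedI => [e1 e2 d e12 /restrictE f1 /restrictE f2|x d xI /restrictE].
  suff: incl sFG (inr e1) = incl sFG (inr e2) by case/incl_inj.
  congr inr; apply: (umor_inj _ f1 f2).
  by rewrite !start_fincl e12.
rewrite /= -start_fincl => /(umor_lift (interior_fincl sFG xI))[e ex fe].
have [e' e'x e'e] := interior_star xI ex.
by exists e' => //; apply/restrictE; rewrite /= e'e.
Qed.

Lemma restrict_is_mor : is_mor restrict_fun.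
Proof.
split.
- move=> x; case fx: (restrict_fun _) => [y|d]; first by exists y.
  move/restrictE: fx => /=.
  by have [y ->] := mor_vert (mor_is_mor f) (fincl (sub_verts sFG) x).
- by move=> x y /restrictE /(maps_inter fFK); apply.
- move=> e d /restrictE /(mor_edge (mor_is_mor f)) [fs ff fr].
  move: fs ff fr; rewrite !start_fincl !finish_fincl !rev_fincl => fs ff fr.
  by split; apply/restrictE.
- move=> e y /restrictE /(mor_collapse (mor_is_mor f)) [fr fs ff].
  move: fs ff fr; rewrite !start_fincl !finish_fincl !rev_fincl => fs ff fr.
  by split; apply/restrictE.
- move=> x y fx xI; exists 1 => d dy.
  by have := restrict_unramified fx dy; rewrite xI.
Qed.

(** The restriction of [f] to [F] and [K], again an unramified morphism: an
    interior vertex of [F] keeps all its edges, and every fibre over an edge of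
    [K] at the image of an interior vertex has one element. *)
Definition restrict : umor F K :=
  UMor (umor_mor := Mor restrict_is_mor) restrict_unramified.

Lemma cval_restrict c c0 : cval c = cval c0 -> cval (restrict c) = cval (f c0).
Proof.
by rewrite ffunE cval_cell_of -(cval_incl sFG) => /cval_inj ->.
Qed.

End Restrict.

End Restriction.

Section InclusionMorphism.
Variables (U W : choiceType) (F G : dgraph U W) (sFG : subdgraph F G).

Lemma id_maps_into : maps_into (idu G) F G.
Proof.
split=> [c _|x y]; first exact: in_cells_cval.
rewrite ffunE => -[<-] xF; have xV := fsubsetP (inter_sub F) _ xF.
exact: (interior_fincl sFG (x := [` xV])).
Qed.

(** The inclusion of a sub-∂-graph, as an unramified morphism: a restriction of
    the identity. *)
Definition inclu : umor F G := restrict sFG (subdgraph_refl G) id_maps_into.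

Lemma cval_inclu c : cval (inclu c) = cval c.
Proof.
by rewrite (cval_restrict _ _ _ (esym (cval_incl sFG c))) ffunE cval_incl.
Qed.

End InclusionMorphism.

(** * Unramified morphisms from flowers *)

Section FlowerMorphism.
Variables (U W U' W' : choiceType).
Implicit Types (F G : dgraph U W) (H K : dgraph U' W').

Lemma collapse_interior F H (f : umor F H) (e : edges F) (y : verts H) :
  flower F -> f (inr e) = inl y -> interior y.
Proof.
move=> [_ noE _] /(mor_collapse (mor_is_mor f)) [_ fs ff].
move: (noE e); apply: contraR => yB; apply/andP.
by split; [move: fs | move: ff]; move/(mor_inter (mor_is_mor f)) => /contra; apply.
Qed.

Lemma flower_star F (x : verts F) : flower F -> boundary x ->
  exists e : edges F, start e = x.
Proof.
move=> [_ _ noV] xB; have := noV x; rewrite /isolated_boundary_vertex xB.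
by case/set0Pn => e; rewrite inE => /eqP; exists e.
Qed.

(** The key step: layer-stripping the target removes nothing that a flower can
    reach. *)
Lemma flower_maps_into F H K (f : umor F H) :
  flower F -> layer_strip H K -> maps_into f F K.
Proof.
move=> flF; have mf := mor_is_mor f.
have bdry (x : verts F) (y : verts H) :
    f (inl x) = inl y -> boundary y -> boundary x.
  by move=> fx; apply/contra/(mor_inter mf fx).
have noE (e : edges F) : ~~ boundary_edge e by case: flF.
have noS (e : edges F) : ~~ boundary_spike e by case: flF.
case=> [x xP Kv Ke Ki _|e eP Kv Ke Ki _|e eP Kv Ke Ki _].
- case/andP: xP => xB /eqP x0.
  (* No vertex [v] maps to [x]: an edge at [v] would be collapsed to [x]. *)
  have nox (v : verts F) : f (inl v) <> inl x.
    move=> fv; have [e ev] := flower_star flF (bdry _ _ fv xB).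
    case fe: (f (inr e)) => [y|d].
      have [_] := mor_collapse mf fe; rewrite ev fv => -[yx] _.
      by have := collapse_interior flF fe; rewrite -yx; apply/negP.
    have [] := mor_edge mf fe; rewrite ev fv => -[xd] _ _.
    by have := in_set0 d; rewrite -x0 inE xd eqxx.
  have noc (c : cell F) : f c <> inl x.
    by case: c => [v|e fe]; [apply: nox | have [_ /nox] := mor_collapse mf fe].
  split=> [c _|v y fv]; last by rewrite Ki => /(mor_inter mf fv).
  case fc: (f c) => [y|d] /=; last by rewrite Ke fsvalP.
  rewrite Kv !inE fsvalP andbT (inj_eq val_inj).
  by apply/eqP => yx; apply: (noc c); rewrite fc yx.
- have noe (d : edges F) : f (inr d) <> inr e.
    move=> fd; have [fs ff _] := mor_edge mf fd; case/andP: eP => sB fB.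
    by have /negP[] := noE d; rewrite /boundary_edge (bdry _ _ fs) // (bdry _ _ ff).
  have nor (d : edges F) : f (inr d) <> inr (rev e).
    by move/(mor_edge mf) => [_ _]; rewrite revK; apply: noe.
  split=> [c _|v y fv]; last by rewrite Ki => /(mor_inter mf fv).
  case fc: (f c) => [y|d] /=; first by rewrite Kv fsvalP.
  case: c fc => [v|c] fc; first by have [y] := mor_vert mf v; rewrite fc.
  rewrite Ke in_edgesD2; apply/andP; split; apply/eqP => de; rewrite de in fc.
    exact: (noe c).
  exact: (nor c).
- case/and3P: eP => fI sB /eqP oute.
  (* No vertex [v] maps to [start e]: all edges at [v] would map to [e], so [v]
     would have a single edge, a boundary spike or a boundary edge. *)
  have nos (v : verts F) : f (inl v) <> inl (start e).
    move=> fv; have vB := bdry _ _ fv sB.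
    have fout (d : edges F) : start d = v -> f (inr d) = inr e.
      move=> dv; case fd: (f (inr d)) => [y|d'].
        have [_] := mor_collapse mf fd; rewrite dv fv => -[yx] _.
        by have := collapse_interior flF fd; rewrite -yx => /(negP sB).
      have [] := mor_edge mf fd; rewrite dv fv => -[xd] _ _.
      by congr inr; apply/set1P; rewrite -oute inE xd.
    have [d dv] := flower_star flF vB.
    have outd : out (start d) = [set d].
      apply/setP => d'; rewrite !inE; apply/eqP/eqP => [d'd|-> //].
      by apply: (umor_inj d'd (fout d' _) (fout d dv)); rewrite d'd.
    case dfI: (interior (finish d)).
      by have /negP[] := noS d; rewrite /boundary_spike dfI dv vB -dv outd eqxx.
    by have /negP[] := noE d; rewrite /boundary_edge dv vB; apply: (negbT dfI).
  have noe (d : edges F) : f (inr d) <> inr e.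
    by move/(mor_edge mf) => [/nos].
  have nor (d : edges F) : f (inr d) <> inr (rev e).
    by move/(mor_edge mf) => [_ _]; rewrite revK; apply: noe.
  split=> [c _|v y fv].
    case: c => [v|c].
      have [y fv] := mor_vert mf v; rewrite fv /= Kv !inE fsvalP andbT.
      by rewrite (inj_eq val_inj); apply/eqP => yx; apply: (nos v); rewrite fv yx.
    case fc: (f (inr c)) => [y|d] /=.
      rewrite Kv !inE fsvalP andbT (inj_eq val_inj); apply/eqP => yx.
      by have [_] := mor_collapse mf fc; rewrite yx => /nos.
    rewrite Ke in_edgesD2; apply/andP; split; apply/eqP => de; rewrite de in fc.
      exact: (noe c).
    exact: (nor c).
  (* An interior vertex mapped to [finish e] would have an edge mapped to
     [rev e]. *)
  move=> vI; rewrite Ki in_fsetD1 (inj_eq val_inj); apply/andP.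
  split; last exact: (mor_inter mf fv vI).
  apply/eqP => ye; rewrite ye in fv.
  by have [d _ /nor] := umor_lift vI fv.
Qed.

Lemma flower_factor F H K (f : umor F H) : flower F -> layer_strips H K ->
  exists g : umor F K, forall c, cval (g c) = cval (f c).
Proof.
move=> flF HK; elim: HK f => [{}H {}K HK|{}H|H1 H2 H3 _ IH12 _ IH23] f.
- have sKH : subdgraph K H by case: HK.
  exists (restrict (subdgraph_refl F) sKH (flower_maps_into f flF HK)) => c.
  exact: cval_restrict.
- by exists f.
have [g gf] := IH12 f; have [h hg] := IH23 g.
by exists h => c; rewrite hg gf.
Qed.

Lemma Fl_maps_into G H (f : umor G H) : maps_into f (Fl G) (Fl H).
Proof.
pose i := inclu (Fl_sub G).
have [g gP] := flower_factor (compu f i) (Fl_flower G) (Fl_strips H).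
have {}gP c c0 : cval c = cval c0 -> cval (g c) = cval (f c0).
  rewrite gP ffunE => cc0; congr (cval (f _)); apply: cval_inj.
  by rewrite cval_inclu.
split=> [c cF|x y fx xI].
  by rewrite -(gP (cell_of cF)) ?cval_cell_of ?in_cells_cval.
have xF := fsubsetP (inter_sub _) _ xI.
have := gP (inl [` xF]) (inl x) erefl.
have [z gx] := mor_vert (mor_is_mor g) [` xF].
rewrite fx gx => -[zy]; rewrite -[val y]zy.
exact: (mor_inter (mor_is_mor g) gx xI).
Qed.

(** The action of [Fl] on morphisms. *)
Definition Fl_map G H (f : umor G H) : umor (Fl G) (Fl H) :=
  restrict (Fl_sub G) (Fl_sub H) (Fl_maps_into f).

Lemma cval_Fl_map G H (f : umor G H) c c0 :
  cval c = cval c0 -> cval (Fl_map f c) = cval (f c0).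
Proof. exact: cval_restrict. Qed.

Lemma Fl_sub_preim G H (f : umor G H) :
  subdgraph (Fl G) (preim_dgraph f (Fl_sub H)).
Proof.
have [fc fi] := Fl_maps_into f; have sFG := Fl_sub G.
split=> /=.
- apply/fsubsetP => u uF; have uG := fsubsetP (sub_verts sFG) u uF.
  by have /= -> := preim_vertsP f (Fl H) [` uG]; apply: fc.
- apply/fsubsetP => w wF; have wG := fsubsetP (sub_edges sFG) w wF.
  by have /= -> := preim_edgesP f (Fl H) [` wG]; apply: fc.
- by move=> e e' ee'; rewrite ffunE; apply: (sub_start sFG).
- by move=> e e' ee'; rewrite ffunE; apply: (sub_rev sFG).
move=> x x' xx' xI; split.
  pose y := fincl (sub_verts sFG) x.
  apply/imfsetP; exists y; rewrite //= inE interior_fincl //=.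
  by have [z fy] := mor_vert (mor_is_mor f) y; rewrite fy; apply: fi fy xI.
pose pG := preim_edge_sub f (Fl H).
apply/fsetP => w; apply/imfsetP/imfsetP => -[e /=]; rewrite inE => /eqP ex ->.
  have eG := fsubsetP (sub_edges sFG) _ (fsvalP e).
  have eP : val e \in preim_edges f (Fl H).
    by have /= -> := preim_edgesP f (Fl H) [` eG]; apply/fc/fsvalP.
  exists [` eP] => //=; rewrite inE; apply/eqP/val_inj; rewrite ffunE /= -xx' -ex.
  by apply: esym; apply: (sub_start sFG).
have ex0 : start (fincl pG e) = fincl (sub_verts sFG) x.
  by apply: val_inj; rewrite /= xx' -ex ffunE.
have [d dx de] := interior_star xI ex0.
by exists d; [rewrite /= inE dx | apply: esym (congr1 val de)].
Qed.

End FlowerMorphism.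

(** * Uniqueness of the flower *)

Section FlowerClass.
Variables U W : choiceType.
Implicit Types F G : dgraph U W.

Lemma flower_strips_sub G F K : layer_strips G F -> layer_strips G K ->
  flower F ->
  [/\ verts F `<=` verts K, edges F `<=` edges K & inter F `<=` inter K].
Proof.
move=> /layer_strips_sub sFG GK flF.
have [g gP] := flower_factor (inclu sFG) flF GK.
have {}gP c : cval (g c) = cval c by rewrite gP cval_inclu.
split; apply/fsubsetP => u uF.
- by have := in_cells_cval (g (inl [` uF])); rewrite gP.
- by have := in_cells_cval (g (inr [` uF])); rewrite gP.
have uV := fsubsetP (inter_sub F) _ uF.
have := gP (inl [` uV]); have [z gz] := mor_vert (mor_is_mor g) [` uV].
by rewrite gz => -[<-]; apply: (mor_inter (mor_is_mor g) gz uF).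
Qed.

Lemma Fl_unique G F : layer_strips G F -> flower F -> F = Fl G.
Proof.
move=> GF flF.
have [V1 E1 I1] := flower_strips_sub GF (Fl_strips G) flF.
have [V2 E2 I2] := flower_strips_sub (Fl_strips G) GF (Fl_flower G).
apply: dgraph_eq; try by apply/eqP; rewrite eqEfsubset; apply/andP.
have sFG := layer_strips_sub GF; have sFlG := Fl_sub G.
move=> e e' ee'; pose d := fincl (sub_edges sFG) e.
rewrite (sub_start sFG (e' := d)) // (sub_rev sFG (e' := d)) //.
by rewrite (sub_start sFlG (e' := d)) // (sub_rev sFlG (e' := d)).
Qed.

Lemma Fl_id F : flower F -> Fl F = F.
Proof. by move=> flF; apply/esym/Fl_unique => //; apply: rt_refl. Qed.

Lemma Fl_equivalent G K : layerably_equivalent G K -> Fl G = Fl K.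
Proof.
have FlE G1 G2 : layer_strip G1 G2 -> Fl G1 = Fl G2.
  move=> G12; apply/esym/Fl_unique; last exact: Fl_flower.
  by apply: rt_trans (Fl_strips G2); apply: rt_step.
by elim=> [G1 G2 [/FlE|/FlE ->]|//|G1 G2 G3 _ -> _ ->].
Qed.

Lemma layer_strips_equivalent G K :
  layer_strips G K -> layerably_equivalent G K.
Proof.
elim=> [G1 G2 G12|G1|G1 G2 G3 _ eq12 _ eq23].
- by apply: rt_step; left.
- exact: rt_refl.
exact: rt_trans eq12 eq23.
Qed.

End FlowerClass.

(** * The functor Fl and its inclusion into the identity *)

Definition Fl_functor : @functor dgraph_category dgraph_category
  (fun G : fin_dgraph => FinDGraph (Fl G)).
Proof.
refine (@Functor dgraph_category dgraph_category
  (fun G : fin_dgraph => FinDGraph (Fl G)) (fun G H f => Fl_map f) _ _).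
- move=> G; apply: umor_eq => c; apply: cval_inj.
  rewrite (cval_Fl_map _ (esym (cval_incl (Fl_sub G) c))).
  by rewrite !ffunE cval_incl.
- move=> G H K g f; apply: umor_eq => c; apply: cval_inj.
  have c0 := esym (cval_incl (Fl_sub G) c).
  rewrite (cval_Fl_map _ c0) ffunE [in RHS]ffunE.
  exact: esym (cval_Fl_map _ (cval_Fl_map _ c0)).
Defined.

Definition Fl_inclusion : nat_trans Fl_functor (id_functor dgraph_category).
Proof.
refine (@NatTrans _ _ _ _ Fl_functor (id_functor dgraph_category)
  (fun G : fin_dgraph => inclu (Fl_sub G)) _).
move=> G H f; apply: umor_eq => c; apply: cval_inj; rewrite ffunE [in RHS]ffunE.
have c0 := cval_Fl_map f (esym (cval_inclu (Fl_sub G) c)).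
exact: etrans (cval_inclu (Fl_sub H) (Fl_map f c)) c0.
Defined.

Theorem theorem6p11 :
  exists Fl : forall U W : choiceType, dgraph U W -> dgraph U W,
  [/\ (forall (U W : choiceType) (G : dgraph U W),
         [/\ layer_strips G (Fl U W G), flower (Fl U W G)
           & forall F : dgraph U W,
               layer_strips G F -> flower F -> F = Fl U W G]),
      (forall (U W : choiceType) (G : dgraph U W),
         exists! F : dgraph U W, layerably_equivalent G F /\ flower F),
      (forall (U W U' W' : choiceType) (G : dgraph U W) (H : dgraph U' W')
              (f : umor G H),
         exists sFl : subdgraph (Fl U' W' H) H,
           subdgraph (Fl U W G) (preim_dgraph f sFl))
    & exists (phi : @functor dgraph_category dgraph_category
                      (fun G : fin_dgraph => FinDGraph (Fl _ _ G)))
             (iota : nat_trans phi (id_functor dgraph_category)),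
        (forall (G H : fin_dgraph) (f : umor G H)
                (c : cell (Fl _ _ G)) (c0 : cell G),
           cval c = cval c0 ->
           cval ((fmap phi f : umor (Fl _ _ G) (Fl _ _ H)) c) = cval (f c0))
        /\ (forall (G : fin_dgraph) (c : cell (Fl _ _ G)),
           cval ((component iota G : umor (Fl _ _ G) G) c) = cval c)].
Proof.
exists Fl; split.
- move=> U W G; split; [exact: Fl_strips | exact: Fl_flower | exact: Fl_unique].
- move=> U W G; exists (Fl G); split=> [|F [GF flF]].
    by split; [apply/layer_strips_equivalent/Fl_strips | apply: Fl_flower].
  by rewrite (Fl_equivalent GF) Fl_id.
- by move=> U W U' W' G H f; exists (Fl_sub H); apply: Fl_sub_preim.
exists Fl_functor, Fl_inclusion; split=> [G H f c c0|G c].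
  exact: cval_Fl_map.
exact: cval_inclu.
Qed.
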